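(* Let $g_0, g_1,\ldots,g_m:\mathbb{R}^n\to\mathbb{R}$ be polynomials, let $p_i:=\deg(g_i)$, and let $\phi_{i,p_i}$ denote the homogeneous component of $g_i$ of degree $p_i$, for $i\in\{0,1,\ldots,m\}$. Let $$\mathcal{D}^\star := \{ d \in \mathbb{S}^{n-1} : (g_i)_\infty(d) < 0 \ \text{ for all } i \in \{0,1,\ldots,m\}\}.$$ Suppose that for every direction $d \in \mathcal{D}^\star$ there exists an index $i \in \{0,1,\ldots,m\}$ such that $\phi_{i,p_i}(d) = 0$. Then $\sigma(\mathcal{D}^\star) = 0$.
   Context: Here $g_0=f$ plays the role of the objective and $g_1,\ldots,g_m$ of the constraints of the problem $\inf\{f(x): g_i(x)\le 0,\ i=1,\ldots,m\}$. $\mathbb{S}^{n-1}$ is the Euclidean unit sphere in $\mathbb{R}^n$, and $\sigma$ is the normalized surface measure on it: $\sigma(A)=\mathcal{H}^{n-1}(A)/\mathcal{H}^{n-1}(\mathbb{S}^{n-1})$, where $\mathcal{H}^{n-1}$ is $(n-1)$-dimensional Hausdorff measure. For a polynomial $h:\mathbb{R}^n\to\mathbb{R}$, write its unique decomposition $h=\sum_{k=0}^{p}\phi_k$ with each $\phi_k$ a homogeneous polynomial of degree $k$ (possibly zero). For $d\in\mathbb{R}^n\setminus\{0\}$ let $\mu(d):=\max\{k:\phi_k(d)\neq 0\}$. The asymptotic value $h_\infty(d)\in[-\infty,+\infty]$ is: $h_\infty(d)=-\infty$ if $\mu(d)\ge 2$ and $\phi_{\mu(d)}(d)<0$; $h_\infty(d)=+\infty$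 if $\mu(d)\ge 2$ and $\phi_{\mu(d)}(d)>0$; $h_\infty(d)=\phi_1(d)$ if $\mu(d)=1$; and $h_\infty(d)=0$ if $\phi_k(d)=0$ for all $k\ge 1$. Equivalently, $h_\infty(d)=\lim_{t\to\infty} h(td)/t$. *)

(* Defs.v *)
From HB Require Import structures.
From mathcomp Require Import all_boot all_order all_algebra.
From mathcomp Require Import all_classical all_reals all_analysis.
From mathcomp Require mpoly.
(* The notations of mpoly clash with those of MathComp-Analysis. *)
Import (canonicals, coercions) mpoly.

Set Implicit Arguments.
Unset Strict Implicit.
Unset Printing Implicit Defensive.

Import Order.TTheory GRing.Theory Num.Theory.
Import numFieldNormedType.Exports.

Local Open Scope classical_set_scope.
Local Open Scope ring_scope.

Section Polynomials.
Variables (R : realType) (n : nat).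
Implicit Types (h : mpoly.mpoly n R) (d : 'rV[R]_n).

Definition peval h d : R := mpoly.meval (fun i => d 0 i) h.

(* Total degree; the zero polynomial gets degree 0. *)
Definition pdeg h : nat := (mpoly.msize h).-1.

Definition hcomp h (k : nat) : mpoly.mpoly n R :=
  mpoly.pihomog (@mpoly.mdeg n) k h.

(* The largest k with phi_k(d) != 0; it is 0 when there is no such k, so that
   mu h d = 0 exactly when phi_k(d) = 0 for all k >= 1. *)
Definition mu h d : nat :=
  (\max_(k < (pdeg h).+1 | (peval (hcomp h k) d != 0)%R) k)%N.

(* When mu h d >= 2 the value phi_{mu h d}(d) is nonzero, so the last branch
   of the inner test is the case of a positive value. *)
Definition asymptotic_value h d : \bar R :=
  if (2 <= mu h d)%N then
    if peval (hcomp h (mu h d)) d < 0 then -oo%E else +oo%E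
  else if mu h d == 1%N then (peval (hcomp h 1) d)%:E
  else 0%E.

End Polynomials.

Section HausdorffMeasure.
Variables (R : realType) (n : nat).
Implicit Types (A U : set 'rV[R]_n).

(* The norm that 'rV[R]_n carries in the library is the maximum norm. *)
Definition enorm (x : 'rV[R]_n) : R := Num.sqrt (\sum_i x 0 i ^+ 2).

Definition sphere : set 'rV[R]_n := [set x | enorm x = 1].

Local Open Scope ereal_scope.

(* Equal to -oo on the empty set. *)
Definition diam U : \bar R :=
  ereal_sup [set (enorm (x - y))%:E | x in U & y in U].

(* diam(U)^k, with the empty set counting for 0 also when k = 0. *)
Definition diam_pow (k : nat) U : \bar R :=
  if `[< U = set0 >] then 0 else diam U ^+ k.

Definition hausdorff_pre (k : nat) (delta : R) A : \bar R :=
  ereal_inf [set \sum_(0 <= i <oo) diam_pow k (U i) |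
    U in [set U : (set 'rV[R]_n)^nat |
      A `<=` \bigcup_i U i /\ forall i, diam (U i) <= delta%:E]].

(* k-dimensional Hausdorff (outer) measure, without the conventional constant
   factor depending on k, which cancels in [sigma]. *)
Definition hausdorff (k : nat) A : \bar R :=
  ereal_sup [set hausdorff_pre k delta A | delta in [set delta | (0 < delta)%R]].

Definition sigma A : \bar R := hausdorff n.-1 A / hausdorff n.-1 sphere.

End HausdorffMeasure.

Definition Dstar (R : realType) (n m : nat) (g : 'I_m.+1 -> mpoly.mpoly n R) :
    set 'rV[R]_n :=
  [set d | sphere d /\ forall i, (asymptotic_value (g i) d < 0)%E].

(* Main.v *)
Require Import Defs.
From HB Require Import structures.
From mathcomp Require Import all_boot all_order all_algebra.
From mathcomp Require Import ring lra.
From mathcomp Require Import all_classical all_reals all_analysis.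
From mathcomp Require mpoly.
Import (canonicals, coercions) mpoly.

Import Order.TTheory GRing.Theory Num.Theory.
Local Open Scope classical_set_scope.
Local Open Scope ring_scope.

(** Two facts reduce the theorem to one about zero sets.  A polynomial with a
    negative asymptotic value is nonzero, so its component of top degree is a
    nonzero homogeneous polynomial; hence the hypothesis puts the set of
    directions inside finitely many sets {d in S : phi(d) = 0} with phi nonzero
    and homogeneous.  It remains to see that each of these is null for the
    (n-1)-dimensional Hausdorff measure ([sphere_zeros_null]).

    Cover the sphere by the charts d |-> y = d / d_i, whose values lie on the
    hyperplane y_i = 1; by homogeneity the zeros of phi go to zeros of phi.  Let
    j be a coordinate different from i such that the j-th partial derivative of
    phi is not the zero polynomial.  A zero y of phi is either a zero of this
    derivative, which is again homogeneous and of smaller degree, or a point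
    where the derivative is nonzero.  Induction on the degree takes care of the
    former ([chart_zeros_null]).  It ends at the polynomials all of whose
    partial derivatives along j != i vanish: these are the c X_i^D, which have
    no zero on y_i = 1 ([chart_zeros_const]).

    The regular zeros are exhausted by countably many strata, on which y is
    bounded and the derivative is bounded away from 0.  On a stratum, Taylor's
    formula makes y_j locally a Lipschitz function of the other coordinates
    ([regular_zeros_close]); since y_i is constant, n - 2 coordinates remain,
    and at scale 1/N a stratum is covered by O(N^(n-2)) sets of diameter O(1/N)
    ([stratum_null]).  The sum of the (n-1)-th powers of these diameters is
    O(1/N) ([hausdorff_null_codes]). *)

(** * Null sets of the Hausdorff measures *)

Section NullSets.
Variables (R : realType) (n : nat).
Implicit Types (k : nat) (A U : set 'rV[R]_n).

(** The infinite cost of the sets of large diameter turns the constraint on the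
    covers in [hausdorff_pre] into a property of the cost alone. *)
Definition small_cost k (delta : R) U : \bar R :=
  (if diam U <= delta%:E then diam_pow k U else +oo)%E.

Lemma enorm_ge0 (x : 'rV[R]_n) : 0 <= enorm x.
Proof. exact: sqrtr_ge0. Qed.

Lemma diam_pow_ge0 k U : (0 <= diam_pow k U)%E.
Proof.
rewrite /diam_pow; case: asboolP => // /eqP/set0P[x Ux]; apply: expe_ge0.
apply: (@le_trans _ _ (enorm (x - x))%:E); first by rewrite lee_fin enorm_ge0.
by apply: ereal_sup_ubound; exists x => //; exists x.
Qed.

Lemma small_cost_ge0 k delta U : (0 <= small_cost k delta U)%E.
Proof. by rewrite /small_cost; case: ifP => // _; exact: diam_pow_ge0. Qed.

(** When all sets are measurable, every cover is admissible in [mu_ext], as it is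
    in [hausdorff_pre].  The base point is arbitrary. *)
Definition rowPointedType : pointedType :=
  HB.pack 'rV[R]_n (isPointed.Build 'rV[R]_n 0).

Definition discreteType := g_sigma_algebraType [set: set rowPointedType].

(** This identification gives access to countable subadditivity. *)
Lemma hausdorff_preE k delta A :
  hausdorff_pre k delta A =
  @mu_ext _ discreteType R (small_cost k delta) A.
Proof.
apply/eqP; rewrite eq_le; apply/andP; split.
- apply: le_ereal_inf_tmp => _ [U [_ AU] <-].
  have [[i /negP Ui]|small] := pselect (exists i, ~ (diam (U i) <= delta%:E)%E).
    rewrite (@nneseries_pinfty _ _ _ i) ?leey//.
      by move=> j _; exact: small_cost_ge0.
    by rewrite /small_cost (negbTE Ui).
  have {}small i : (diam (U i) <= delta%:E)%E.
    by apply: contrapT => h; apply: small; exists i.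
  apply: ereal_inf_lbound; exists U; first by split.
  by apply: eq_eseriesr => i _; rewrite /small_cost small.
- apply: le_ereal_inf_tmp => _ [U [AU small] <-].
  apply: ereal_inf_lbound; exists U.
    by split=> // i; exact: sub_sigma_algebra.
  by apply: eq_eseriesr => i _; rewrite /small_cost small.
Qed.

Lemma hausdorff_pre_ge0 k delta A : (0 <= hausdorff_pre k delta A)%E.
Proof. by rewrite hausdorff_preE; apply: mu_ext_ge0; exact: small_cost_ge0. Qed.

Lemma hausdorff_nullP k A :
  hausdorff k A = 0%E <-> forall delta, 0 < delta -> hausdorff_pre k delta A = 0%E.
Proof.
split=> [A0 delta d0|A0]; apply/eqP; rewrite eq_le.
  rewrite hausdorff_pre_ge0 andbT -A0.
  by apply: ereal_sup_ubound; exists delta.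
apply/andP; split; first by apply/ereal_supP => _ [delta d0 <-]; rewrite A0.
apply: le_ereal_sup_tmp; exists (hausdorff_pre k 1 A); last by rewrite A0.
by exists 1 => //=.
Qed.

Lemma hausdorff_null_sub_bigcup k A (F : (set 'rV[R]_n)^nat) :
  (forall i, hausdorff k (F i) = 0%E) -> A `<=` \bigcup_i F i ->
  hausdorff k A = 0%E.
Proof.
move=> F0 AF; apply/hausdorff_nullP => delta d0; apply/eqP.
rewrite eq_le hausdorff_pre_ge0 andbT hausdorff_preE.
apply: (le_trans (@le_mu_ext _ discreteType _ (small_cost k delta) _ _ AF)).
apply: (le_trans (@mu_ext_sigma_subadditive _ discreteType _ _ (@small_cost_ge0 _ _) F)).
rewrite eseries0// => i _ _; rewrite -hausdorff_preE.
by move/hausdorff_nullP: (F0 i); exact.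
Qed.

Lemma hausdorff_null_subset k A B :
  A `<=` B -> hausdorff k B = 0%E -> hausdorff k A = 0%E.
Proof.
move=> AB B0; apply: (@hausdorff_null_sub_bigcup _ _ (fun=> B)) => // x /AB Bx.
by exists 0%N.
Qed.

Lemma hausdorff0 k : hausdorff k (set0 : set 'rV[R]_n) = 0%E.
Proof.
apply/hausdorff_nullP => delta d0; rewrite hausdorff_preE.
apply: (@mu_ext0 _ discreteType); last exact: small_cost_ge0.
rewrite /small_cost ifT; last by apply/ereal_supP => _ [x []].
by rewrite /diam_pow; case: asboolP.
Qed.

Lemma hausdorff_null_sub_countable k (I : countType) A (F : I -> set 'rV[R]_n) :
  (forall i, hausdorff k (F i) = 0%E) -> A `<=` \bigcup_i F i ->
  hausdorff k A = 0%E.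
Proof.
move=> F0 AF; pose G m := if unpickle m is Some i then F i else set0.
apply: (@hausdorff_null_sub_bigcup _ _ G) => [m|x /AF[i _ Fix]].
  by rewrite /G; case: unpickle => [i|]; [exact: F0|exact: hausdorff0].
by exists (pickle i) => //; rewrite /G pickleK.
Qed.

(** The box-counting criterion: a set of upper box dimension at most [k] is null
    in dimension [k.+1], because its cover at scale 1/N has total cost
    O(N^k (1/N)^(k+1)).  The pieces of the cover are given as the fibres of a
    code with values in a finite type. *)
Lemma hausdorff_null_codes k A (D C : R) :
  0 <= C ->
  (forall N, (0 < N)%N -> exists (I : finType) (code : 'rV[R]_n -> I),
     #|I|%:R <= D * N%:R ^+ k /\
     forall x y, A x -> A y -> code x = code y -> enorm (x - y) <= C / N%:R) ->
  hausdorff k.+1 A = 0%E.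
Proof.
move=> C0 cover; apply/hausdorff_nullP => delta d0; apply/eqP.
rewrite eq_le hausdorff_pre_ge0 andbT; apply/lee_addgt0Pr => e e0; rewrite add0e.
(* both the mesh C / N and the total cost D C^(k+1) / N must be small *)
have [N N0 [CN DN]] : exists2 N : nat, (0 < N)%N &
    C / N%:R <= delta /\ D * C ^+ k.+1 / N%:R <= e.
  pose b := Num.max (C / delta) (D * C ^+ k.+1 / e).
  exists (Num.truncn b).+1 => //.
  have bN : b <= (Num.truncn b).+1%:R by rewrite ltW// truncnS_gt.
  rewrite !ler_pdivrMr ?ltr0n//; split.
    by rewrite [leRHS]mulrC -ler_pdivrMr//; apply: le_trans bN; rewrite le_max lexx.
  by rewrite [leRHS]mulrC -ler_pdivrMr//; apply: le_trans bN; rewrite le_max lexx orbT.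
have [I [code [cardI codeP]]] := cover N N0.
have Npos : 0 < N%:R :> R by rewrite ltr0n.
pose r := C / N%:R; have r0 : 0 <= r by rewrite divr_ge0// ltW.
pose U (i : nat) := [set x | A x /\ nat_of_ord (enum_rank (code x)) = i].
have diamU i : (diam (U i) <= r%:E)%E.
  apply/ereal_supP => _ [x [Ax xi]] [y [Ay yi]] <-; rewrite lee_fin.
  apply: codeP => //; apply: enum_rank_inj; apply: val_inj.
  by rewrite /= xi yi.
have costU i : (diam_pow k.+1 (U i) <= (if (i < #|I|)%N then r ^+ k.+1 else 0)%:E)%E.
  rewrite /diam_pow; case: asboolP => [U0|/eqP/set0P[x [Ax xi]]].
    by case: ifP => _; rewrite lee_fin// exprn_ge0.
  have -> : (i < #|I|)%N by rewrite -xi ltn_ord.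
  have Dr := diamU i.
  have D0 : (0 <= diam (U i))%E.
    apply: (@le_trans _ _ (enorm (x - x))%:E); first by rewrite lee_fin enorm_ge0.
    by apply: ereal_sup_ubound; exists x => //; exists x.
  have Dfin : diam (U i) = (fine (diam (U i)))%:E.
    rewrite fineK// ge0_fin_numE//; exact: le_lt_trans Dr (ltry _).
  rewrite Dfin in Dr D0 *.
  rewrite -EFin_expe lee_fin lerXn2r// ?nnegrE//.
apply: (@le_trans _ _ (\sum_(0 <= i <oo) diam_pow k.+1 (U i))%E).
  apply: ereal_inf_lbound; exists U => //; split=> [x Ax|i].
    by exists (enum_rank (code x)).
  by apply: le_trans (diamU i) _; rewrite lee_fin.
apply: lime_le; first by apply: is_cvg_nneseries => i _ _; exact: diam_pow_ge0.
apply: nearW => L.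
apply: le_trans; first by apply: lee_sum => i _; exact: costU.
rewrite sumEFin lee_fin big_mkord.
have -> : \sum_(i < L) (if (i < #|I|)%N then r ^+ k.+1 else 0) =
    (minn L #|I|)%:R * r ^+ k.+1.
  elim: L => [|L IH]; first by rewrite big_ord0 min0n mul0r.
  rewrite big_ord_recr/= IH; case: ltnP => h.
    by rewrite (minn_idPl _)// ?(minn_idPl _)// ?(ltnW h)// -natr1 mulrDl mul1r.
  by rewrite (minn_idPr _)// ?(minn_idPr _)// ?addr0//; exact: leqW.
apply: (@le_trans _ _ (#|I|%:R * r ^+ k.+1)).
  by rewrite ler_wpM2r ?exprn_ge0// ler_nat geq_minr.
apply: le_trans DN; apply: (@le_trans _ _ (D * N%:R ^+ k * r ^+ k.+1)).
  by rewrite ler_wpM2r ?exprn_ge0.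
rewrite /r exprMn exprVn [N%:R ^+ k.+1]exprS.
rewrite le_eqVlt; apply/orP; left; apply/eqP; field.
by rewrite lt0r_neq0//= expf_neq0// lt0r_neq0.
Qed.

End NullSets.

(** * Local estimates for polynomial functions *)

Section PolynomialEstimates.
Variables (R : realType) (n : nat).
Implicit Types (p q : mpoly.mpoly n R) (x y : 'rV[R]_n) (M r : R) (i j l : 'I_n).

Lemma mpoly_ring_ind (P : mpoly.mpoly n R -> Prop) :
  (forall c, P (mpoly.mpolyC n c)) ->
  (forall i, P (mpoly.mpolyX R (mpoly.mnm1 i))) ->
  (forall p q, P p -> P q -> P (p + q)) ->
  (forall p q, P p -> P q -> P (p * q)) -> forall p, P p.
Proof.
move=> PC PX PD PM p; rewrite [p]mpoly.mpolyE; apply: big_ind => //.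
  by rewrite -mpoly.mpolyC0; exact: PC.
move=> m _; rewrite -mpoly.mul_mpolyC; apply: (PM) => //.
rewrite mpoly.mpolyXE_id; apply: big_ind => //.
  by rewrite -mpoly.mpolyC1; exact: PC.
move=> i _; elim: (m i) => [|k IH].
  by rewrite expr0 -mpoly.mpolyC1; exact: PC.
by rewrite exprS; exact: PM.
Qed.

Definition inbox M x := forall l, `|x 0 l| <= M.

Lemma pevalC c x : peval (mpoly.mpolyC n c) x = c.
Proof. exact: mpoly.mevalC. Qed.
Lemma peval0 x : peval 0 x = 0.
Proof. by rewrite -mpoly.mpolyC0 pevalC. Qed.
Lemma pevalX i x : peval (mpoly.mpolyX R (mpoly.mnm1 i)) x = x 0 i.
Proof. exact: mpoly.mevalXU. Qed.
Lemma pevalD p q x : peval (p + q) x = peval p x + peval q x.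
Proof. exact: mpoly.mevalD. Qed.
Lemma pevalM p q x : peval (p * q) x = peval p x * peval q x.
Proof. exact: mpoly.mevalM. Qed.

Lemma peval_bounded p M :
  exists2 C, 0 <= C & forall x, inbox M x -> `|peval p x| <= C.
Proof.
elim/mpoly_ring_ind: p => [c|i|p q [C C0 Cp] [D D0 Dq]|p q [C C0 Cp] [D D0 Dq]].
- by exists `|c| => // x _; rewrite pevalC.
- by exists `|M| => // x xM; rewrite pevalX; exact: le_trans (xM i) (ler_norm M).
- exists (C + D); first exact: addr_ge0.
  by move=> x xM; rewrite pevalD (le_trans (ler_normD _ _))// lerD// ?Cp ?Dq.
- exists (C * D); first exact: mulr_ge0.
  by move=> x xM; rewrite pevalM normrM ler_pM// ?Cp ?Dq.
Qed.

Lemma peval_lipschitz p M : exists2 C, 0 <= C & forall x y r,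
  inbox M x -> inbox M y -> 0 <= r -> (forall l, `|y 0 l - x 0 l| <= r) ->
  `|peval p y - peval p x| <= C * r.
Proof.
elim/mpoly_ring_ind: p => [c|i|p q [C C0 Cp] [D D0 Dq]|p q [C C0 Cp] [D D0 Dq]].
- by exists 0 => // x y r _ _ r0 _; rewrite !pevalC subrr normr0 mul0r.
- by exists 1 => // x y r _ _ r0 xy; rewrite !pevalX mul1r.
- exists (C + D); first exact: addr_ge0.
  move=> x y r xM yM r0 xy; rewrite !pevalD opprD addrACA mulrDl.
  by rewrite (le_trans (ler_normD _ _))// lerD// ?Cp ?Dq.
- have [B B0 Bp] := peval_bounded p M; have [E E0 Eq] := peval_bounded q M.
  exists (C * E + B * D); first by rewrite addr_ge0// mulr_ge0.
  move=> x y r xM yM r0 xy; rewrite !pevalM.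
  have -> : peval p y * peval q y - peval p x * peval q x =
    (peval p y - peval p x) * peval q y + peval p x * (peval q y - peval q x).
    by ring.
  have -> : (C * E + B * D) * r = (C * r) * E + B * (D * r) by ring.
  rewrite (le_trans (ler_normD _ _))// !normrM lerD//.
    by rewrite ler_pM// ?Cp ?Eq.
  by rewrite ler_pM// ?Bp ?Dq.
Qed.

(** Taylor's formula in the [j]-th variable alone: the other variables may move
    by [r], which is charged to the error at first order.  In this form the
    estimate is stable under products, where the new term is the product of the
    two increments, of order (r + |t|)^2 = O(r + t^2) for r <= 1. *)
Lemma peval_taylor p j M : exists2 C, 0 <= C & forall x y r,
  inbox M x -> inbox M y -> 0 <= r <= 1 ->
  (forall l, l != j -> `|y 0 l - x 0 l| <= r) ->
  `|peval p y - peval p x - peval (mpoly.mderiv j p) x * (y 0 j - x 0 j)| <=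
    C * (r + (y 0 j - x 0 j) ^+ 2).
Proof.
elim/mpoly_ring_ind: p => [c|i|p q [C C0 Cp] [D D0 Dq]|p q [C C0 Cp] [D D0 Dq]].
- exists 0 => // x y r _ _ r0 _.
  have -> : peval (mpoly.mderiv j (mpoly.mpolyC n c)) x = 0.
    by rewrite mpoly.mderivC; exact: peval0.
  by rewrite !pevalC subrr mul0r subr0 normr0 mul0r.
- exists 1 => // x y r _ _ r0 xy; rewrite !pevalX mul1r mpoly.mderivX.
  rewrite mpoly.mnm1E; case: eqVneq => [->|ij].
    have -> : (mpoly.mnm_sub (mpoly.mnm1 j) (mpoly.mnm1 j)) = mpoly.mnm0.
      by apply/mpoly.mnmP => l; rewrite mpoly.mnmBE subnn mpoly.mnm0E.
    rewrite scale1r mpoly.mpolyX0 -mpoly.mpolyC1 pevalC mul1r subrr.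
    by rewrite normr0 addr_ge0// ?sqr_ge0//; case/andP: r0.
  rewrite scale0r peval0 mul0r subr0.
  by apply: le_trans (xy _ ij) _; rewrite lerDl sqr_ge0.
- exists (C + D); first exact: addr_ge0.
  move=> x y r xM yM r0 xy; rewrite mpoly.mderivD !pevalD mulrDl.
  have -> : forall a b c d e f : R,
    a + b - (c + d) - (e + f) = (a - c - e) + (b - d - f) by move=> *; ring.
  by rewrite mulrDl (le_trans (ler_normD _ _))// lerD// ?Cp ?Dq.
- have [B B0 Bp] := peval_bounded p M; have [E E0 Eq] := peval_bounded q M.
  have [F F0 Fp] := peval_lipschitz p M; have [G G0 Gq] := peval_lipschitz q M.
  exists (B * D + E * C + 2 * F * G).
    by rewrite !addr_ge0 ?mulr_ge0.
  move=> x y r xM yM r01 xy; have /andP[r0 r1] := r01.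
  rewrite mpoly.mderivM !pevalD !pevalM.
  set t := y 0 j - x 0 j; set p' := peval (mpoly.mderiv j p) x.
  set q' := peval (mpoly.mderiv j q) x.
  have rt0 : 0 <= r + `|t| by rewrite addr_ge0.
  have xy_rt l : `|y 0 l - x 0 l| <= r + `|t|.
    by have [->|lj] := eqVneq l j; [rewrite lerDr|rewrite (le_trans (xy l lj))// lerDl].
  have -> : peval p y * peval q y - peval p x * peval q x -
      (p' * peval q x + peval p x * q') * t =
      peval p x * (peval q y - peval q x - q' * t) +
      peval q x * (peval p y - peval p x - p' * t) +
      (peval p y - peval p x) * (peval q y - peval q x) by ring.
  rewrite [leRHS]mulrDl (le_trans (ler_normD _ _))// lerD//.
    rewrite [leRHS]mulrDl (le_trans (ler_normD _ _))// lerD// normrM -mulrA ler_pM//.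
    - exact: Bp.
    - exact: Dq.
    - exact: Eq.
    - exact: Cp.
  rewrite normrM; apply: (@le_trans _ _ (F * (r + `|t|) * (G * (r + `|t|)))).
    by rewrite ler_pM// ?Fp ?Gq.
  have -> : F * (r + `|t|) * (G * (r + `|t|)) = F * G * (r + `|t|) ^+ 2 by ring.
  have -> : 2 * F * G * (r + t ^+ 2) = F * G * (2 * (r + t ^+ 2)) by ring.
  rewrite ler_wpM2l ?mulr_ge0// -(real_normK (num_real t)).
  have rr : r ^+ 2 <= r by rewrite expr2 ler_piMl.
  have -> : (r + `|t|) ^+ 2 = 2 * (r ^+ 2 + `|t| ^+ 2) - (r - `|t|) ^+ 2 by ring.
  by rewrite lerBlDr (le_trans _ (ler_wpDr (sqr_ge0 _) (lexx _)))// ler_wpM2l// lerD2r.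
Qed.

End PolynomialEstimates.
Arguments inbox {R n}.

(** * Regular zeros in a chart of the sphere *)

Section Strata.
Variables (R : realType) (n : nat).
Implicit Types (p q : mpoly.mpoly n R) (x y d e : 'rV[R]_n) (i j l : 'I_n).

(** A quantitative implicit function theorem.  With t the increment in the
    [j]-th variable, Taylor's formula at two zeros gives c |t| <= C (r + t^2);
    for |t| <= c / (2 C) the term C t^2 is absorbed by the left-hand side, and
    |t| <= (2 C / c) r. *)
Lemma regular_zeros_close p j (M c : R) : 0 < c ->
  exists (K : nat) (L : R), 1 <= L /\ forall x y r,
    inbox M x -> inbox M y -> peval p x = 0 -> peval p y = 0 ->
    c <= `|peval (mpoly.mderiv j p) x| -> `|y 0 j - x 0 j| <= K.+1%:R^-1 ->
    0 <= r <= 1 -> (forall l, l != j -> `|y 0 l - x 0 l| <= r) ->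
    forall l, `|y 0 l - x 0 l| <= L * r.
Proof.
move=> c0; have [C C0 taylor] := peval_taylor R n p j M.
exists (Num.truncn (2 * C / c)), (1 + 2 * C / c); split.
  by rewrite lerDl divr_ge0// ?mulr_ge0// ltW.
move=> x y r xM yM px py cx yxj r01 xy l; have /andP[r0 _] := r01.
have [->|/xy xyl] := eqVneq l j; last first.
  by apply: le_trans xyl _; rewrite ler_peMl// lerDl divr_ge0// ?mulr_ge0// ltW.
have := taylor x y r xM yM r01 xy.
rewrite px py subrr sub0r normrN normrM -(real_normK (num_real (y 0 j - x 0 j))).
set t := `|_ - _| in yxj *; set K := _.+1%:R in yxj; move=> h.
have t0 : 0 <= t by exact: normr_ge0.
have K0 : 0 < K by rewrite ltr0n.
have Ct : C * t <= c / 2.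
  apply: (@le_trans _ _ (C * K^-1)); first by rewrite ler_wpM2l.
  rewrite ler_pdivrMr// mulrAC ler_pdivlMr//.
  rewrite [leRHS]mulrC -ler_pdivrMr// [C * 2]mulrC.
  exact: ltW (truncnS_gt _).
have ct : c * t <= C * r + c / 2 * t.
  apply: le_trans (_ : C * (r + t ^+ 2) <= _).
    by apply: le_trans h; rewrite ler_wpM2r.
  by rewrite mulrDr lerD2l expr2 mulrA ler_wpM2r.
apply: (@le_trans _ _ (2 * C / c * r)); last by rewrite ler_wpM2r// lerDr.
rewrite mulrAC ler_pdivlMr//; lra.
Qed.

(** The interval [-M, M] is cut into 2 M N intervals of length 1 / N, with one
    more for the right end point. *)
Lemma grid_code (M N : nat) : (0 < N)%N ->
  exists f : R -> 'I_(2 * M * N).+1, forall s t,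
    `|s| <= M%:R -> `|t| <= M%:R -> f s = f t -> `|t - s| <= N%:R^-1.
Proof.
move=> N0; have N0' : 0 < N%:R :> R by rewrite ltr0n.
pose g (t : R) := Num.truncn ((t + M%:R) * N%:R).
have g_itv t : `|t| <= M%:R ->
    (g t)%:R <= (t + M%:R) * N%:R < (g t).+1%:R /\ (g t < (2 * M * N).+1)%N.
  rewrite ler_norml => /andP[tl tr].
  have tN0 : 0 <= (t + M%:R) * N%:R by rewrite mulr_ge0 ?(ltW N0')//; lra.
  split; first exact: truncn_itv.
  rewrite ltnS truncn_le_nat -natr1 ltr_pwDr// !natrM ler_pM2r//.
  have : t + M%:R <= 2%:R * M%:R by lra.
  by [].
exists (fun t => inord (g t)) => s t /g_itv[/andP[sl sr] sM] /g_itv[/andP[tl tr] tM].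
move/(congr1 val); rewrite /= !inordK// => gst.
rewrite -[leRHS]mul1r ler_pdivlMr// -[X in _ * X](gtr0_norm N0') -normrM ler_norml.
rewrite -gst -natr1 in tl tr; rewrite -natr1 in sr.
by apply/andP; split; lra.
Qed.

Definition chart i d : 'rV[R]_n := (d 0 i)^-1 *: d.

Lemma enorm_le_sum x : enorm x <= \sum_l `|x 0 l|.
Proof.
have s0 : 0 <= \sum_l `|x 0 l| by exact: sumr_ge0.
rewrite -(@ler_pXn2r _ 2)// ?nnegrE// ?enorm_ge0// sqr_sqrtr; last first.
  by apply: sumr_ge0 => l _; exact: sqr_ge0.
rewrite expr2 mulr_suml; apply: ler_sum => l _.
rewrite -(real_normK (num_real (x 0 l))) expr2 ler_wpM2l//.
by rewrite (bigD1 l)//= lerDl sumr_ge0.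
Qed.

Lemma sphereE d : sphere d -> \sum_l d 0 l ^+ 2 = 1.
Proof.
rewrite /sphere/= /enorm => d1.
rewrite -[LHS]sqr_sqrtr ?d1 ?expr1n//.
by apply: sumr_ge0 => l _; exact: sqr_ge0.
Qed.

Lemma sphere_coord_le1 d l : sphere d -> `|d 0 l| <= 1.
Proof.
move=> /sphereE d1; rewrite -(@expr_le1 _ 2)// real_normK ?num_real// -d1.
by rewrite (bigD1 l)//= lerDl sumr_ge0// => k _; exact: sqr_ge0.
Qed.

(** The inverse of the chart is Lipschitz on either half of the sphere.  Write
    d = a y and e = b z with y, z the images in the chart.  As d and e have
    norm 1, a^2 - b^2 = a^2 |e|^2 - b^2 |d|^2 = a^2 b^2 (|z|^2 - |y|^2), and dividing
    by |a| + |b| bounds |a - b| by n r a b; the factor b then absorbs the possibly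
    large coordinates of z, since those of e = b z are at most 1. *)
Lemma sphere_chart_close i d e (r : R) : sphere d -> sphere e ->
  0 < d 0 i * e 0 i -> 0 <= r ->
  (forall l, `|chart i e 0 l - chart i d 0 l| <= r) ->
  enorm (d - e) <= n%:R * n.+1%:R * r.
Proof.
move=> dS eS ab0 r0 de.
set a := d 0 i in ab0; set b := e 0 i in ab0.
have a0 : a != 0 by apply: contraTneq ab0 => ->; rewrite mul0r ltxx.
have b0 : b != 0 by apply: contraTneq ab0 => ->; rewrite mulr0 ltxx.
have dE l : d 0 l = a * chart i d 0 l by rewrite mxE mulrA divff// mul1r.
have eE l : e 0 l = b * chart i e 0 l by rewrite mxE mulrA divff// mul1r.
have ab : `|a| * `|b| = a * b by rewrite -normrM gtr0_norm.
have sum_ab : `|a - b| * (`|a| + `|b|) = `|a ^+ 2 - b ^+ 2|.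
  rewrite subr_sqr normrM; congr (_ * _).
  have [a_ge0|a_lt0] := leP 0 a.
    have b_ge0 : 0 <= b by rewrite ltW// -(pmulr_rgt0 _ (_ : 0 < a))// lt0r a0.
    by rewrite !ger0_norm// addr_ge0.
  have b_lt0 : b < 0 by rewrite -(nmulr_rgt0 _ a_lt0).
  by rewrite !ltr0_norm ?opprD//; lra.
have a_sub_b : `|a - b| <= n%:R * r * (a * b).
  have abp : 0 < `|a| + `|b| by rewrite ltr_wpDr// normr_gt0.
  rewrite -(ler_pM2r abp) sum_ab.
  have -> : a ^+ 2 - b ^+ 2 =
      a * b * \sum_l (chart i e 0 l - chart i d 0 l) * (a * e 0 l + b * d 0 l).
    rewrite -[a ^+ 2]mulr1 -[b ^+ 2]mulr1 -{1}(sphereE _ eS) -(sphereE _ dS).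
    rewrite !mulr_sumr -sumrB; apply: eq_bigr => l _.
    by rewrite dE eE; ring.
  rewrite normrM (gtr0_norm ab0).
  have -> : n%:R * r * (a * b) * (`|a| + `|b|) =
      a * b * (n%:R * (r * (`|a| + `|b|))) by ring.
  rewrite ler_pM2l// (le_trans (ler_norm_sum _ _ _))//.
  rewrite -[X in X%:R * _]card_ord mulr_natl -sumr_const; apply: ler_sum => l _.
  rewrite normrM ler_pM// (le_trans (ler_normD _ _))// !normrM.
  by rewrite lerD// ler_piMr// sphere_coord_le1.
have coord l : `|(d - e) 0 l| <= n.+1%:R * r.
  have -> : (d - e) 0 l =
      a * (chart i d 0 l - chart i e 0 l) + (a - b) * chart i e 0 l.
    by rewrite !mxE -/a -/b; field; rewrite a0 b0.
  rewrite -natr1 [leRHS]mulrDl [leRHS]addrC (le_trans (ler_normD _ _))// lerD//.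
    by rewrite normrM distrC ler_pM// ?de// sphere_coord_le1.
  rewrite normrM (le_trans (ler_wpM2r (normr_ge0 _) a_sub_b))//.
  have -> : n%:R * r * (a * b) * `|chart i e 0 l| = n%:R * r * (`|a| * `|e 0 l|).
    by rewrite -ab eE normrM; ring.
  rewrite -[leRHS]mulr1 ler_wpM2l ?mulr_ge0//.
  by rewrite mulr_ile1// sphere_coord_le1.
apply: le_trans (enorm_le_sum _) _.
rewrite -mulrA -[X in X%:R * _]card_ord mulr_natl -sumr_const.
by apply: ler_sum => l _; exact: coord.
Qed.

End Strata.
Arguments chart {R n}.

(** * Null sets of zeros of homogeneous polynomials *)

Section Nullity.
Variables (R : realType) (n : nat).
Implicit Types (p q : mpoly.mpoly n R) (x y d e : 'rV[R]_n) (i j l : 'I_n).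

(** One level [M] governs both the size of the chart coordinates and the lower
    bound on the derivative, so that the strata form a sequence. *)
Definition stratum i j p (M : nat) : set 'rV[R]_n :=
  [set d | [/\ sphere d, d 0 i != 0, peval p (chart i d) = 0,
    M.+1%:R^-1 <= `|peval (mpoly.mderiv j p) (chart i d)| &
    inbox M%:R (chart i d)]].

Lemma chart_self i d : d 0 i != 0 -> chart i d 0 i = 1.
Proof. by move=> di; rewrite mxE mulVf. Qed.

Lemma card_other2 i j : j != i -> (#|[pred l | (l != i) && (l != j)]|.+2 = n)%N.
Proof.
move=> ji; rewrite -[RHS]card_ord [RHS](cardD1 i).
rewrite [X in (_ + X)%N](cardD1 j) !inE ji !add1n.
by do 2![congr S]; apply: eq_card => l; rewrite !inE andbT andbC.
Qed.

(** At scale 1/N a point is coded by the cells of size 1/N of its n - 2 chart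
    coordinates other than the [i]-th, which is 1, and the [j]-th.  The code also
    records the sign of d_i and a cell of the [j]-th coordinate whose size, fixed
    once and for all, is small enough for [regular_zeros_close]: the number of
    values of these two is a constant. *)
Lemma stratum_null i j p M : j != i -> hausdorff n.-1 (stratum i j p M) = 0%E.
Proof.
move=> ji; have /(congr1 predn) := card_other2 _ _ ji.
set k := #|_| => /= <-.
have M1 : 0 < M.+1%:R^-1 :> R by rewrite invr_gt0 ltr0n.
have [K [L [L1 close]]] := regular_zeros_close R n p j M%:R M.+1%:R^-1 M1.
have L0 : 0 <= L by exact: le_trans L1.
have [g gP] := grid_code R M K.+1 isT.
apply: (@hausdorff_null_codes _ _ _ _
  (2 * (2 * M * K.+1).+1%:R * (2 * M).+1%:R ^+ k) (n%:R * n.+1%:R * L)).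
  by rewrite !mulr_ge0.
move=> N N0; have [f fP] := grid_code R M N N0.
exists (bool * {ffun {l : 'I_n | (l != i) && (l != j)} -> 'I_(2 * M * N).+1} *
  'I_(2 * M * K.+1).+1)%type.
exists (fun d => (0 < d 0 i, [ffun l => f (chart i d 0 (val l))],
  g (chart i d 0 j))); split.
  rewrite !card_prod card_bool card_ffun card_sig !card_ord -/k.
  rewrite -!natrX -!natrM ler_nat.
  have : (((2 * M * N).+1 ^ k) <= ((2 * M).+1 ^ k) * N ^ k)%N.
    rewrite -expnMn; case: (k) => // k'; rewrite leq_exp2r//.
    by rewrite mulSn -[X in (X <= _)%N]add1n leq_add2r.
  move=> h; rewrite -!mulnA in h *.
  by rewrite leq_pmul2l// [leqLHS]mulnC leq_pmul2l.
move=> d e [dS di pd cd dM] [eS ei pe ce eM] [sgn_de /ffunP cols coarse].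
rewrite -mulrA; apply: (sphere_chart_close _ _ i) => //.
- have [d_gt0|d_le0] := ltP 0 (d 0 i).
    by rewrite mulr_gt0// -sgn_de.
  have e_le0 : e 0 i <= 0 by rewrite leNgt -sgn_de -leNgt.
  by rewrite nmulr_rgt0 lt_neqAle ?di ?ei.
- by rewrite mulr_ge0.
- apply: close => //.
  + exact: gP.
  + by rewrite invr_ge0 ler0n/= invf_le1 ?ler1n// ltr0n.
  + move=> l lj; have [->|li] := eqVneq l i.
      by rewrite !chart_self// subrr normr0.
    have lij : (l != i) && (l != j) by rewrite li lj.
    by apply: fP => //; have := cols (exist _ l lij); rewrite !ffunE.
Qed.

Definition chart_zeros i p : set 'rV[R]_n :=
  [set d | [/\ sphere d, d 0 i != 0 & peval p (chart i d) = 0]].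

Lemma dhomog_mderiv D j p : p \is mpoly.ishomog1 D (@mpoly.mdeg n) ->
  mpoly.mderiv j p != 0 ->
  exists2 D', D = D'.+1 & mpoly.mderiv j p \is mpoly.ishomog1 D' (@mpoly.mdeg n).
Proof.
move=> /mpoly.dhomogP hp p'0.
have hm m : m \in mpoly.msupp (mpoly.mderiv j p) -> (mpoly.mdeg m).+1 = D.
  rewrite mpoly.mcoeff_msupp mpoly.mcoeff_deriv => pm.
  have : mpoly.mdeg (mpoly.mnm_add m (mpoly.mnm1 j)) = D.
    apply: hp; rewrite mpoly.mcoeff_msupp.
    by apply: contraNneq pm => ->; rewrite mul0rn.
  by rewrite mpoly.mdegD mpoly.mdeg1 addn1.
exists (mpoly.mdeg (mpoly.mlead (mpoly.mderiv j p))).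
  by rewrite (hm _ (mpoly.mlead_supp p'0)).
apply/mpoly.dhomogP => m /hm mD; apply: succn_inj.
by rewrite (hm _ (mpoly.mlead_supp p'0)); exact: mD.
Qed.

Lemma mderiv_eq0_exp0 j p m : mpoly.mderiv j p = 0 -> m \in mpoly.msupp p ->
  m j = 0%N.
Proof.
move=> p'0 mp; apply/eqP; apply: contraT => mj.
have jm := mpoly.lep1mP j m; rewrite mj in jm.
have := congr1 (mpoly.mcoeff (mpoly.mnm_sub m (mpoly.mnm1 j))) p'0.
rewrite mpoly.mcoeff_deriv mpoly.submK// mpoly.mcoeff0 => /eqP.
by rewrite mulrn_eq0/= (negbTE (_ : _ != 0))// -mpoly.mcoeff_msupp.
Qed.

(** Every monomial of [p] involves only the [i]-th variable and has degree [D]: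
    p = c X_i^D, which takes the value c wherever the [i]-th coordinate is 1. *)
Lemma chart_zeros_const i p D : p \is mpoly.ishomog1 D (@mpoly.mdeg n) ->
  p != 0 -> (forall j, j != i -> mpoly.mderiv j p = 0) ->
  chart_zeros i p = set0.
Proof.
move=> /mpoly.dhomogP hp p0 p'0; rewrite -subset0 => d [_ di] /eqP; apply/negP.
have exp0 m j : m \in mpoly.msupp p -> j != i -> m j = 0%N.
  by move=> mp /p'0 /mderiv_eq0_exp0; exact.
have expi m : m \in mpoly.msupp p -> m i = D.
  move=> mp; have <- : mpoly.mdeg m = D by exact: hp.
  rewrite mpoly.mdegE (bigD1 i)//= big1 ?addn0// => j.
  exact: exp0.
have all_lead m : m \in mpoly.msupp p -> m = mpoly.mlead p.
  move=> mp; have lp := mpoly.mlead_supp p0; apply/mpoly.mnmP => l.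
  by have [->|li] := eqVneq l i; rewrite ?expi// !exp0.
rewrite /peval mpoly.mevalE.
rewrite (bigD1_seq (mpoly.mlead p)) ?mpoly.msupp_uniq ?mpoly.mlead_supp//=.
rewrite [X in _ + X]big_seq_cond [X in _ + X]big1 ?addr0 => [|m /andP[mp]];
  last by rewrite (all_lead _ mp) eqxx.
rewrite big1 ?mulr1 ?mpoly.mleadc_eq0// => l _.
have [->|li] := eqVneq l i; first by rewrite chart_self// expr1n.
by rewrite exp0// mpoly.mlead_supp.
Qed.

(** The strata of all levels exhaust the zeros of [p] at which the chosen
    derivative is nonzero; the other zeros are zeros of that derivative. *)
Lemma chart_zeros_null D i p : p \is mpoly.ishomog1 D (@mpoly.mdeg n) ->
  p != 0 -> hausdorff n.-1 (chart_zeros i p) = 0%E.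
Proof.
elim/ltn_ind: D p => D IH p hp p0.
have [[j ji p'0]|noj] := pselect (exists2 j, j != i & mpoly.mderiv j p != 0);
  last first.
  rewrite (chart_zeros_const _ _ _ hp) ?hausdorff0// => j ji.
  by apply/eqP; apply: contrapT => /negP p'0; apply: noj; exists j.
have [D' DD' hp'] := dhomog_mderiv _ _ _ hp p'0.
pose F M :=
  if M is M'.+1 then stratum i j p M' else chart_zeros i (mpoly.mderiv j p).
apply: (@hausdorff_null_sub_bigcup _ _ _ _ F) => [[|M]|d [dS di pd]].
- by apply: IH hp' p'0; rewrite DD'.
- exact: stratum_null.
- have [qd|qd] := eqVneq (peval (mpoly.mderiv j p) (chart i d)) 0.
    by exists 0%N.
  set y := chart i d in pd qd *; set q := peval _ _ in qd.
  pose b := `|q|^-1 + \sum_l `|y 0 l|.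
  have bM : b <= (Num.truncn b).+1%:R by rewrite ltW// truncnS_gt.
  exists (Num.truncn b).+2 => //; split=> //.
  + rewrite -/q -[leRHS]invrK lef_pV2 ?posrE ?invr_gt0 ?normr_gt0// ?ltr0n//.
    apply: (@le_trans _ _ b); first by rewrite lerDl sumr_ge0.
    by apply: (le_trans bM); rewrite ler_nat.
  + move=> l; apply: le_trans bM; rewrite -/y.
    by rewrite ler_wpDl ?invr_ge0// (bigD1 l)//= lerDl sumr_ge0.
Qed.

Lemma peval_scale D c p x : p \is mpoly.ishomog1 D (@mpoly.mdeg n) ->
  peval p (c *: x) = c ^+ D * peval p x.
Proof.
move/mpoly.dhomogP => hp; rewrite /peval !mpoly.mevalE mulr_sumr.
rewrite !big_seq; apply: eq_bigr => m mp.
have <- : mpoly.mdeg m = D by exact: hp.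
rewrite mpoly.mdegE -prodrXr mulrCA -big_split/=; congr (_ * _).
by apply: eq_bigr => l _; rewrite mxE exprMn.
Qed.

(** A point of the sphere has a nonzero coordinate, hence lies in some chart. *)
Lemma sphere_zeros_null D p : p \is mpoly.ishomog1 D (@mpoly.mdeg n) ->
  p != 0 -> hausdorff n.-1 [set d | sphere d /\ peval p d = 0] = 0%E.
Proof.
move=> hp p0.
apply: (@hausdorff_null_sub_countable _ _ _ _ _ (fun i => chart_zeros i p)).
  by move=> i; exact: chart_zeros_null hp p0.
move=> d [dS pd].
have [i di] : exists i, d 0 i != 0.
  apply/existsP; apply: contraT => /existsPn d0.
  have := sphereE _ _ _ dS; rewrite big1 => [/esym/eqP|l _]; first by rewrite oner_eq0.
  by have := d0 l; rewrite negbK => /eqP ->; rewrite expr0n.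
by exists i => //; split=> //; rewrite /chart (peval_scale _ _ _ _ hp) pd mulr0.
Qed.

Lemma hcomp_lead_neq0 (h : mpoly.mpoly n R) : h != 0 -> hcomp h (pdeg h) != 0.
Proof.
move=> h0; apply: contraNneq (h0) => hc0.
rewrite -mpoly.mleadc_eq0; have := congr1 (mpoly.mcoeff (mpoly.mlead h)) hc0.
rewrite mpoly.mcoeff0 /hcomp mpoly.pihomogE linear_sum/=.
have dl : mpoly.mdeg (mpoly.mlead h) = pdeg h.
  by rewrite /pdeg -mpoly.mlead_deg.
rewrite -big_filter (bigD1_seq (mpoly.mlead h))/=; last 2 first.
- by rewrite mem_filter dl eqxx mpoly.mlead_supp.
- by rewrite filter_uniq// mpoly.msupp_uniq.
rewrite big1 ?addr0 => [|m ml].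
  by rewrite mpoly.mcoeffZ mpoly.mcoeffX eqxx mulr1 => ->.
by rewrite mpoly.mcoeffZ mpoly.mcoeffX (negbTE ml) mulr0.
Qed.

Lemma asymptotic_value0 d : asymptotic_value (0 : mpoly.mpoly n R) d = 0%E.
Proof.
rewrite /asymptotic_value; suff -> : mu (0 : mpoly.mpoly n R) d = 0%N by [].
rewrite /mu big_pred0// => k; rewrite /hcomp.
by rewrite linear0 peval0 eqxx.
Qed.

End Nullity.

Theorem theorem7 (R : realType) (n m : nat) (hn : (0 < n)%N)
    (g : 'I_m.+1 -> mpoly.mpoly n R)
    (hD : forall d : 'rV[R]_n, Dstar g d ->
       exists i : 'I_m.+1, peval (hcomp (g i) (pdeg (g i))) d = 0) :
  sigma (Dstar g) = 0%E.
Proof.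
rewrite /sigma.
(* a zero numerator makes the quotient 0 whatever the extended real below it *)
suff -> : hausdorff n.-1 (Dstar g) = 0%E by rewrite mul0e.
pose Z i := [set d : 'rV[R]_n | g i != 0 /\
  sphere d /\ peval (hcomp (g i) (pdeg (g i))) d = 0].
apply: (@hausdorff_null_sub_countable _ _ _ _ _ Z) => [i|d dD].
  have [gi0|gi0] := eqVneq (g i) 0.
    suff -> : Z i = set0 by exact: hausdorff0.
    by rewrite -subset0 => d []; rewrite gi0 eqxx.
  have Zi : Z i `<=` [set d | sphere d /\ peval (hcomp (g i) (pdeg (g i))) d = 0].
    by move=> d [].
  apply: hausdorff_null_subset Zi _.
  exact: sphere_zeros_null (mpoly.pihomogP _ _ _) (hcomp_lead_neq0 _ _ _ gi0).
have [i id0] := hD d dD; have [dS neg] := dD.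
exists i => //; split=> //; apply: contraTneq (neg i) => ->.
by rewrite asymptotic_value0 ltxx.
Qed.
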